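(* Let $\beta\in[0,1]$. For every real polynomial $P\in S(\beta)$ of degree $4$ we have $d(P,\beta) \le 1-\frac{1}{3}\beta(1-\beta)$.
   Context: For a complex number $\beta$ with $|\beta|\le 1$, $S(\beta)$ denotes the set of polynomials of degree at least $2$ with complex coefficients, having all their roots in the closed unit disk $\{z\in\mathbb{C}: |z|\le 1\}$ and at least one root at $\beta$. For a polynomial $P$ (of degree at least $2$), $d(P,\beta)$ denotes the distance between $\beta$ and the closest (complex) root of the derivative $P'$, i.e. $d(P,\beta)=\min\{|\beta-\zeta| : \zeta\in\mathbb{C},\ P'(\zeta)=0\}$. A real polynomial is one with real coefficients (its roots may be non-real). *)

(* Defs.v *)
(* The reals are an arbitrary [R : realType] and the complex numbers are [R[i]]. *)
From HB Require Import structures.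
From mathcomp Require Export all_boot all_order all_algebra.
From mathcomp Require Export complex.
From mathcomp Require Export boolp classical_sets reals.

Set Implicit Arguments.
Unset Strict Implicit.
Unset Printing Implicit Defensive.

Import Order.TTheory GRing.Theory Num.Theory.
Local Open Scope classical_set_scope.
Local Open Scope ring_scope.
Local Open Scope complex_scope.

(* The norm [`|z|] of [R[i]] takes values in [R[i]]; [normc z] is the same
   modulus as an element of [R]. *)
Notation normc := ComplexField.Normc.normc.

(* Degree at least 2 is [2 < size P]. *)
Definition polyS (R : realType) (beta : R[i]) : set {poly R[i]} :=
  [set P : {poly R[i]} | [/\ (2 < size P)%N, forall z, root P z -> normc z <= 1
             & root P beta]].

(* The infimum is a minimum when [deg P >= 2]; see [critical_distance_min]. *)
Definition critical_distance (R : realType) (P : {poly R[i]}) (beta : R[i]) :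
    R :=
  inf [set normc (beta - zeta) | zeta in [set zeta | root P^`() zeta]].

Lemma critical_distance_min (R : realType) (P : {poly R[i]}) (beta : R[i]) :
  (2 < size P)%N ->
  (exists2 zeta, root P^`() zeta &
     critical_distance P beta = normc (beta - zeta)) /\
  (forall zeta, root P^`() zeta ->
     critical_distance P beta <= normc (beta - zeta)).
Proof.
move=> sP.
have sD : size P^`() = (size P).-1.
  by rewrite size_poly_eq // -mulr_natr mulf_neq0 ?pnatr_eq0 -?lt0n
    ?prednK -?lead_coefE ?lead_coef_eq0 -?size_poly_gt0;
    case: (size P) sP => [|[|]].
have D0 : P^`() != 0 by rewrite -size_poly_gt0 sD; case: (size P) sP => [|[|]].
have [r Dr] := closed_field_poly_normal P^`().
have memr z : root P^`() z = (z \in r).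
  by rewrite Dr rootZ ?lead_coef_eq0 // root_prod_XsubC.
have [w0 rw0] : exists w, w \in r.
  have : size P^`() != 1%N by rewrite sD; case: (size P) sP => [|[|[|]]].
  by move/closed_rootP => [w]; rewrite memr; exists w.
have [w rw wmin] : exists2 w, w \in r &
    forall z, z \in r -> normc (beta - w) <= normc (beta - z).
  elim: r w0 rw0 {Dr memr} => // a r IH w0 _.
  case: r IH => [_|b r IH].
    by exists a => [|z]; rewrite !inE // => /eqP ->.
  have [w rw wmin] := IH b (mem_head _ _).
  have [law|lwa] := leP (normc (beta - a)) (normc (beta - w)).
    exists a; first exact: mem_head.
    by move=> z; rewrite inE => /predU1P[->//|/wmin]; apply: le_trans.
  exists w; first by rewrite inE rw orbT.
  by move=> z; rewrite inE => /predU1P[->|/wmin//]; apply: ltW.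
set A := [set normc (beta - zeta) | zeta in [set zeta | root P^`() zeta]].
have lbA : lbound A (normc (beta - w)).
  by move=> _ [z /= rz <-]; apply: wmin; rewrite -memr.
have Aw : A (normc (beta - w)) by exists w => //=; rewrite memr.
have dE : critical_distance P beta = normc (beta - w).
  apply/le_anti/andP; split.
    by apply: ge_inf => //; exists (normc (beta - w)).
  by apply: lb_le_inf => //; exists (normc (beta - w)).
split; first by exists w; rewrite ?memr.
by move=> z rz; rewrite dE; apply: wmin; rewrite -memr.
Qed.

(* Main.v *)
(* In the variable t = beta - z the polynomial is a multiple of
   t (t - s) (t^2 - 2 u t + v), where s <= 1 + beta, and v <= 1 - beta^2 + 2 beta u
   because the remaining two roots have product at most 1. Suppose that all critical
   points have |t| > D := 1 - beta (1 - beta) / 3. Their product is s v / 4, so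
   |s v| > 4 D^3. If some real root other than beta has |t| <= D, Rolle's theorem gives
   a contradiction; otherwise s v > 4 D^3 forces the derivative in t to be
   nonnegative at t = D, whereas it is - s v < 0 at t = 0, so it vanishes in ]0, D].
   The nonnegativity at D is elementary when 2 s < 3 D; when 2 s >= 3 D it reduces,
   by linearity in u and v and concavity in s, to the case s = 1 + beta,
   s v = 4 D^3, which is a polynomial inequality in beta alone; it has a double zero
   at beta = 1, the case of z^4 - 1. *)
Require Import Defs.
From mathcomp Require Import ring lra polyrcf.
Import Order.TTheory GRing.Theory Num.Theory.
Local Open Scope ring_scope.
Local Open Scope complex_scope.

(** * Inequalities for the real parameters, with D = [radius b] *)

Definition radius {R : realFieldType} (b : R) : R := 1 - 1 / 3 * b * (1 - b).

(** The second bound puts all of [b, 1] within D of b; the third yields s <= 2 D. *)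
Lemma radius_bounds {R : realFieldType} (b : R) : 0 <= b <= 1 ->
  [/\ 11 / 12 <= radius b, 1 - b <= radius b & 1 + b <= 2 * radius b].
Proof.
rewrite /radius => /andP[b0 b1].
have h : 0 <= b * (1 - b) by rewrite mulr_ge0 ?subr_ge0.
move: (sqr_ge0 b) (sqr_ge0 (1 - b)) (sqr_ge0 (b - 1 / 2)); rewrite !expr2 => h1 h2 h3.
by split; lra.
Qed.

Lemma extremal_bound {R : realFieldType} (b : R) : 0 <= b <= 1 ->
  3 * radius b <= 2 * (1 + b) ->
  0 <= (2 * (1 + b) - 3 * radius b) *
         (4 * radius b ^+ 3 - (1 - b ^+ 2) * (1 + b))
       + b * (8 * radius b ^+ 3 - 3 * (1 + b) ^+ 2 * radius b).
Proof.
(* [hb] reads b^2 - 3 b + 1 <= 0, so b >= (3 - sqrt 5) / 2 > 19/50. *)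
move=> /andP[b0 b1] hb; have bge : 19 / 50 <= b by move: hb; rewrite /radius; nra.
pose e := 1 - b.
have -> : b = 1 - e by rewrite /e; ring.
have e0 : 0 <= e by rewrite /e; lra.
have e1 : e <= 31 / 50 by rewrite /e; lra.
(* Expansion at b = 1. The cofactor of e^2 decreases in e and is still positive at e = 31/50. *)
suff h : 0 <= e ^+ 2 * ((135 - 147 * e - 15 * e ^+ 2 - 50 * e ^+ 3 - 4 * e ^+ 6) / 27).
  by apply: (le_trans h); rewrite le_eqVlt /radius; apply/orP; left; apply/eqP; field.
apply: mulr_ge0; first exact: sqr_ge0.
have le_pow n : e ^+ n <= (31 / 50) ^+ n by apply: lerXn2r; rewrite ?nnegrE //; lra.
move: (le_pow 2%N) (le_pow 3%N) (le_pow 6%N); rewrite !exprS !expr0; lra.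
Qed.

(** A quadratic concave in s need only be checked at the ends of [3 D / 2, 1 + b]; at the left end
    it equals 5/4 b D^3. *)
Lemma concave_bound {R : realFieldType} (b s : R) (D := radius b) :
  0 <= b <= 1 -> 3 * D <= 2 * s -> s <= 1 + b ->
  0 <= (2 * s - 3 * D) * (4 * D ^+ 3 - (1 - b ^+ 2) * s)
       + b * (8 * D ^+ 3 - 3 * s ^+ 2 * D).
Proof.
move=> hb hs sb; have [D0 _ _] := radius_bounds _ hb; rewrite -/D in D0.
have [b0 b1] := andP hb.
have D3 : 0 <= b * D ^+ 3 by apply: mulr_ge0 => //; apply: exprn_ge0; lra.
have H1 := extremal_bound _ hb; rewrite -/D in H1.
have [|lt] := leP (2 * (1 + b)) (3 * D).
  move=> le; have -> : s = 3 / 2 * D by lra.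
  have -> : (2 * (3 / 2 * D) - 3 * D) * (4 * D ^+ 3 - (1 - b ^+ 2) * (3 / 2 * D))
     + b * (8 * D ^+ 3 - 3 * (3 / 2 * D) ^+ 2 * D) = 5 / 4 * (b * D ^+ 3) by field.
  lra.
have {}H1 := H1 (ltW lt).
set G1 := (X in 0 <= X) in H1.
have w : 0 < 2 * (1 + b) - 3 * D by lra.
rewrite -(pmulr_rge0 _ w).
(* Chord through the two end values plus the concavity term; 2 (1 - b^2) + 3 b D is minus the
   coefficient of s^2. *)
have -> : (2 * (1 + b) - 3 * D) * ((2 * s - 3 * D) * (4 * D ^+ 3 - (1 - b ^+ 2) * s)
   + b * (8 * D ^+ 3 - 3 * s ^+ 2 * D)) =
   (2 * s - 3 * D) * G1 + (2 * (1 + b - s)) * (5 / 4 * (b * D ^+ 3)) +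
   (2 * (1 - b ^+ 2) + 3 * b * D) *
     ((2 * s - 3 * D) * (1 + b - s) * (2 * (1 + b) - 3 * D) / 2).
  by rewrite /G1; field.
have bD : 0 <= b * D by nra.
rewrite !addr_ge0 ?mulr_ge0 //; try lra.
by nra.
Qed.

Lemma radial_derivative_ge0 {R : realFieldType} (b s u v : R) (D := radius b) :
  0 <= b <= 1 -> D < s -> s <= 1 + b -> 4 * D ^+ 3 < s * v ->
  v <= 1 - b ^+ 2 + 2 * b * u -> 0 <= D ^+ 2 - 2 * u * D + v ->
  0 <= 4 * D ^+ 3 - 3 * (s + 2 * u) * D ^+ 2 + 2 * (v + 2 * u * s) * D - s * v.
Proof.
move=> hb Ds sb sv vu pD.
have [D0 _ bD] := radius_bounds _ hb; rewrite -/D in D0 bD.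
have [b0 b1] := andP hb.
have [lt|le] := ltP (2 * s) (3 * D).
  (* Product rule at t = D for t (t - s) times the quadratic. *)
  have -> : 4 * D ^+ 3 - 3 * (s + 2 * u) * D ^+ 2 + 2 * (v + 2 * u * s) * D - s * v
    = (2 * D - s) * (D ^+ 2 - 2 * u * D + v) + 2 * D * (s - D) * (u - D) by ring.
  have [Du|uD] := leP D u.
    by rewrite addr_ge0 ?mulr_ge0 //; lra.
  (* Otherwise s v <= 2 D^3, since s <= 2 D. *)
  have v2 : D ^+ 2 <= v.
    rewrite leNgt; apply/negP => vD.
    have : s * v <= s * D ^+ 2 by rewrite ler_pM2l; lra.
    have : s * D ^+ 2 <= 2 * D * D ^+ 2 by rewrite ler_wpM2r ?sqr_ge0 //; lra.
    have : 0 < D ^+ 3 by apply: exprn_gt0; lra.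
    by rewrite -mulrA -exprS; lra.
  (* Factor by factor: 2 s < 3 D bounds s - D, and v >= D^2 bounds 2 D (D - u). *)
  have h : (s - D) * (2 * D * (D - u)) <= (2 * D - s) * (D ^+ 2 - 2 * u * D + v).
    by apply: ler_pM; rewrite ?mulr_ge0 //; try lra; nra.
  by lra.
have bpos : 0 < b by lra.
have spos : 0 < s by lra.
have C := concave_bound _ _ hb le sb; rewrite -/D in C.
rewrite -(pmulr_rge0 _ bpos) -(pmulr_rge0 _ spos).
have K0 : 0 <= D * (2 * s - 3 * D) + b * (2 * D - s).
  by rewrite addr_ge0 ?mulr_ge0 //; lra.
(* The coefficient of u is 2 D (2 s - 3 D) >= 0, so the least u allowed by [vu] is the worst case;
   what remains increases with s v, whose lower bound is 4 D^3. The factor s b clears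
   denominators. *)
have -> : s * (b * (4 * D ^+ 3 - 3 * (s + 2 * u) * D ^+ 2 + 2 * (v + 2 * u * s) * D - s * v))
 = D * ((2 * s - 3 * D) * (4 * D ^+ 3 - (1 - b ^+ 2) * s)
       + b * (8 * D ^+ 3 - 3 * s ^+ 2 * D))
  + (D * (2 * s - 3 * D) + b * (2 * D - s)) * (s * v - 4 * D ^+ 3)
  + s * (D * (2 * s - 3 * D)) * (1 - b ^+ 2 + 2 * b * u - v) by ring.
by rewrite !addr_ge0 ?mulr_ge0 //; lra.
Qed.

(** * Real critical points close to b *)

Lemma rolle_near {R : rcfType} (p : {poly R}) (a b D : R) :
  root p a -> root p b -> a != b -> `|b - a| <= D ->
  exists2 x, root p^`() x & `|b - x| <= D.
Proof.
move=> /rootP pa /rootP pb; rewrite real_neqr_lt ?num_real // => /orP[ab|ba] D0.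
  have [|x xab dx] := poly_rolle ab (p := p); first by rewrite pa pb.
  exists x; first exact/rootP.
  move: xab D0; rewrite in_itv /= => /andP[ax xb].
  by rewrite !ler_norml => /andP[? ?]; apply/andP; split; lra.
have [|x xab dx] := poly_rolle ba (p := p); first by rewrite pa pb.
exists x; first exact/rootP.
move: xab D0; rewrite in_itv /= => /andP[bx xa].
by rewrite !ler_norml => /andP[? ?]; apply/andP; split; lra.
Qed.

Lemma quartic_critical_point {R : rcfType} (b l r c1 c0 : R)
    (D := radius b)
    (p := l *: (('X - b%:P) * (('X - r%:P) * ('X ^+ 2 + c1 *: 'X + c0%:P)))) :
  0 <= b <= 1 -> (forall x, root p x -> `|x| <= 1) -> c0 <= 1 ->
  4 * D ^+ 3 < `|(b - r) * (b ^+ 2 + c1 * b + c0)| ->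
  exists2 x, root p^`() x & `|b - x| <= D.
Proof.
move=> hb roots1 c01 prod_gt.
have [D0 bD1 bD2] := radius_bounds _ hb; rewrite -/D in D0 bD1 bD2.
have [b0 b1] := andP hb.
have rootE x : root p x = (l * ((x - b) * ((x - r) * (x ^+ 2 + c1 * x + c0))) == 0).
  by rewrite /root /p !hornerE.
have pb : root p b by rewrite rootE subrr mul0r mulr0.
have pr : root p r by rewrite rootE subrr mul0r !mulr0.
(* A one-sided bound suffices: real roots are at most 1, and 1 - b <= D. *)
have near_root x : root p x -> x != b -> b - x <= D ->
    exists2 x, root p^`() x & `|b - x| <= D.
  move=> px xb bx; apply: (rolle_near _ _ _ _ px pb xb).
  have := roots1 _ px; rewrite !ler_norml => /andP[? ?]; apply/andP; split; lra.
have D3 : 0 < D ^+ 3 by apply: exprn_gt0; lra.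
(* Under z = b - t the quadratic becomes t^2 - 2 u t + v, and [c01] becomes v <= 1 - b^2 + 2 b u. *)
set s := b - r in prod_gt; pose u := b + c1 / 2.
set v := b ^+ 2 + c1 * b + c0 in prod_gt.
have sv0 : s * v != 0 by apply/eqP => sv0; move: prod_gt; rewrite sv0 normr0; lra.
have [s0 v0] : s != 0 /\ v != 0 by apply/andP; rewrite -negb_or -mulf_eq0.
have [sD|Ds] := leP s D.
  by apply: (near_root _ pr _ sD); rewrite eq_sym -subr_eq0.
have sb : s <= 1 + b.
  by have := roots1 _ pr; rewrite /s ler_norml => /andP[? ?]; lra.
have [vneg|] := ltP v 0.
  (* This is t = u - sqrt (u^2 - v) < 0, a root to the right of b. *)
  pose x := b - u + Num.sqrt (u ^+ 2 - v).
  have sq : Num.sqrt (u ^+ 2 - v) ^+ 2 = u ^+ 2 - v.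
    by rewrite sqr_sqrtr //; have := sqr_ge0 u; lra.
  have bx : b < x.
    have := sqrtr_ge0 (u ^+ 2 - v); move: sq; rewrite /x; set w := Num.sqrt _.
    by rewrite !expr2 => sq w0; rewrite ltNge; apply/negP => xb; nra.
  apply: (near_root x); last by lra.
  - rewrite rootE (_ : x ^+ 2 + _ + _ = 0) ?mulr0 //.
    by rewrite /x; move: sq; set w := Num.sqrt _; rewrite /u /v !expr2 => sq; lra.
  - by rewrite gt_eqF.
rewrite le_eqVlt eq_sym (negPf v0) /= => vpos.
have svpos : 4 * D ^+ 3 < s * v.
  by move: prod_gt; rewrite gtr0_norm // mulr_gt0 //; lra.
(* If the quadratic is negative at t = D, it has a root in ]0, D[, being v > 0 at t = 0. *)
have [pD|pD] := ltP (D ^+ 2 - 2 * u * D + v) 0.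
  pose q := 'X ^+ 2 + c1 *: 'X + c0%:P.
  have [||x] := @poly_ivtoo _ q (b - D) b.
  - lra.
  - rewrite /q !hornerE -/v pmulr_llt0 //.
    by move: pD; rewrite /v /u; lra.
  - rewrite in_itv /= => /andP[x1 x2] /rootP; rewrite !hornerE => qx.
    apply: (near_root x); last by lra.
    + by rewrite rootE qx !mulr0.
    + by rewrite lt_eqF.
have fD : 0 <= 4 * D ^+ 3 - 3 * (s + 2 * u) * D ^+ 2 + 2 * (v + 2 * u * s) * D - s * v.
  by apply: radial_derivative_ge0 => //; rewrite -/D // /u /v; lra.
have derE x : p^`().[x] = l * ((x - r) * (x ^+ 2 + c1 * x + c0)
    + (x - b) * (x ^+ 2 + c1 * x + c0) + (x - b) * (x - r) * (2 * x + c1)).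
  by rewrite /p !derivE !hornerE; ring.
(* The end values are - l f and l s v, so their product is nonpositive whatever the sign of l. *)
have [||x] := @polyrcf.poly_ivt _ p^`() (b - D) b.
- by lra.
- set f := (X in 0 <= X) in fD.
  have -> : p^`().[b - D] * p^`().[b] = - (l ^+ 2 * (s * v) * f).
    by rewrite !derE /f /s /u /v; field.
  rewrite oppr_le0; apply: mulr_ge0 => //; apply: mulr_ge0; first exact: sqr_ge0.
  by lra.
rewrite in_itv /= => /andP[? ?] dx; exists x => //.
by rewrite ler_norml; apply/andP; split; lra.
Qed.

(** * Complex moduli and real factorizations *)

Lemma normc_real {R : rcfType} (x : R) : normc x%:C = `|x|.
Proof. by rewrite /normc /= expr0n addr0 sqrtr_sqr. Qed.

Lemma normc_ge0 {R : rcfType} (z : R[i]) : 0 <= normc z.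
Proof. by case: z => x y; apply: sqrtr_ge0. Qed.

(** Over the complex numbers [p.[z]] is the leading coefficient times the product of the differences
    z - w over the roots w. *)
Lemma lead_coef_exp_le_normc {R : rcfType} (p : {poly R[i]}) (z : R[i]) (d : R) :
  0 <= d -> (forall w, root p w -> d <= normc (z - w)) ->
  normc (lead_coef p) * d ^+ (size p).-1 <= normc p.[z].
Proof.
move=> d0 dw.
have [-> | p0] := eqVneq p 0.
  by rewrite lead_coef0 horner0 !ComplexField.Normc.normc0 mul0r.
have [rs pE] := closed_field_poly_normal p.
have rsP w : w \in rs -> d <= normc (z - w).
  by move=> wrs; apply: dw; rewrite pE rootZ ?lead_coef_eq0 // root_prod_XsubC.
have -> : (size p).-1 = size rs.
  by rewrite pE size_scale ?lead_coef_eq0 // size_prod_XsubC.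
rewrite [in leRHS]pE hornerZ ComplexField.Normc.normcM horner_prod.
apply: ler_wpM2l; first exact: normc_ge0.
elim: rs rsP {pE} => [|w rs IH] rsP.
  by rewrite big_nil ComplexField.Normc.normc1.
rewrite big_cons !hornerE ComplexField.Normc.normcM exprS.
apply: ler_pM => //; rewrite ?exprn_ge0 //; first by rewrite rsP ?mem_head.
by apply: IH => v vrs; rewrite rsP // inE vrs orbT.
Qed.

Lemma real_polyP {R : rcfType} (P : {poly R[i]}) : P \is a polyOver Num.real ->
  exists p : {poly R}, P = map_poly (real_complex R) p.
Proof.
move=> /polyOverP Preal; exists (map_poly (@complex.Re R) P).
by apply/polyP => j; rewrite !coef_map /= RRe_real.
Qed.

(** By Vieta, - c1 - w is the second root and c0 is the product of the two. *)
Lemma quadratic_unit_disk {R : rcfType} (c1 c0 : R) :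
  (forall w : R[i], w ^+ 2 + c1%:C * w + c0%:C = 0 -> normc w <= 1) -> c0 <= 1.
Proof.
move=> disk.
pose q : {poly R[i]} := 'X ^+ 2 + c1%:C *: 'X + c0%:C%:P.
have sq : size q = 3%N.
  rewrite /q -addrA size_polyDl size_polyXn // ltnS.
  by rewrite -mul_polyC size_MXaddC; case: ifP => // _; rewrite ltnS size_polyC leq_b1.
have [w] : exists w, root q w by apply/closed_rootP; rewrite sq.
rewrite /root /q !hornerE => /eqP qw.
have qw' : (- c1%:C - w) ^+ 2 + c1%:C * (- c1%:C - w) + c0%:C = 0.
  by rewrite -[RHS]qw; ring.
have prod : w * (- c1%:C - w) = c0%:C by rewrite -[RHS]subr0 -qw; ring.
apply: le_trans (ler_norm _) _.
rewrite -normc_real -prod ComplexField.Normc.normcM -[1]mulr1.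
by apply: ler_pM; rewrite ?normc_ge0 ?disk.
Qed.

(** The cofactor of X - b is a real cubic, hence has a real root r; the quadratic stays unsplit as
    its roots may be non-real. *)
Lemma quartic_factorization {R : rcfType} (p : {poly R}) (b : R) :
  size p = 5%N -> root p b ->
  exists r c1 c0, p = lead_coef p *:
    (('X - b%:P) * (('X - r%:P) * ('X ^+ 2 + c1 *: 'X + c0%:P))).
Proof.
move=> sp /factor_theorem[p1 pE].
have l0 : lead_coef p != 0 by rewrite lead_coef_eq0 -size_poly_eq0 sp.
have p10 : p1 != 0 by apply: contra_neq l0 => p10; rewrite pE p10 mul0r lead_coef0.
have sp1 : size p1 = 4%N.
  by apply/eqP; rewrite -eqSS -sp pE size_Mmonic ?monicXsubC // size_XsubC addn2.
have [r /factor_theorem[p2 p1E]] : {x | root p1 x} by apply: odd_poly_root; rewrite sp1.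
have p20 : p2 != 0 by apply: contra_neq p10 => p20; rewrite p1E p20 mul0r.
have sp2 : size p2 = 3%N.
  by apply/eqP; rewrite -eqSS -sp1 p1E size_Mmonic ?monicXsubC // size_XsubC addn2.
have lE : lead_coef p = p2`_2.
  by rewrite pE p1E !lead_coef_Mmonic ?monicXsubC // lead_coefE sp2.
rewrite lE in l0 *.
exists r, (p2`_1 / p2`_2), (p2`_0 / p2`_2).
have p2E : p2 = p2`_2 *: ('X ^+ 2 + (p2`_1 / p2`_2) *: 'X + (p2`_0 / p2`_2)%:P).
  apply/polyP => -[|[|[|j]]]; rewrite !(coefZ, coefD, coefXn, coefX, coefC) /=.
  - by field.
  - by field.
  - by field.
  - by rewrite nth_default ?sp2 // !mulr0 !addr0 mulr0.
by rewrite {1}pE {1}p1E {1}p2E -!scalerAl mulrC [X in _ *: (_ * X)]mulrC.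
Qed.

Theorem theorem7 (R : realType) (beta : R) (hbeta : 0 <= beta <= 1)
    (P : {poly R[i]}) (hPreal : P \is a polyOver Num.real)
    (hPS : polyS beta%:C P) (hPdeg : size P = 5%N) :
  critical_distance P beta%:C <= 1 - 1 / 3 * beta * (1 - beta).
Proof.
rewrite -[leRHS]/(radius beta).
have [sP disk rootb] := hPS.
have [_ cd_le] := critical_distance_min beta%:C sP.
have [p pE] := real_polyP _ hPreal.
have sp : size p = 5%N by rewrite -hPdeg pE size_map_poly.
have rootP_ x : root P x%:C = root p x by rewrite pE fmorph_root.
have [r [c1 [c0 ]]] := quartic_factorization _ _ sp (etrans (esym (rootP_ _)) rootb).
set l := lead_coef p => pfac.
have l0 : l != 0 by rewrite lead_coef_eq0 -size_poly_eq0 sp.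
have roots1 x : root p x -> `|x| <= 1.
  by rewrite -rootP_ -normc_real; apply: disk.
have c01 : c0 <= 1.
  apply: (quadratic_unit_disk c1) => w qw; apply: disk.
  rewrite pE pfac /root map_polyZ !rmorphM !rmorphD /= map_polyZ !rmorphN !rmorphM /=.
  rewrite map_polyX !map_polyC /=.
  by rewrite !hornerE /= -expr2 qw mulr0.
rewrite leNgt; apply/negP => far.
have [x dx xD] : exists2 x, root p^`() x & `|beta - x| <= radius beta.
  have [D0 _ _] := radius_bounds _ hbeta.
  rewrite pfac; apply: quartic_critical_point => //; first by rewrite -pfac.
  have cd0 : 0 <= critical_distance P beta%:C by lra.
  have lP : P^`() = map_poly (real_complex R) p^`() by rewrite pE deriv_map.
  have p4 : p`_4 = l by rewrite /l lead_coefE sp.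
  have sp' : size p^`() = 4%N.
    by rewrite size_poly_eq sp // -mulr_natr mulf_neq0 ?pnatr_eq0 // p4.
  have lp' : lead_coef p^`() = 4 * l by rewrite lead_coefE sp' coef_deriv p4 mulr_natl.
  have derE : p^`().[beta] = l * ((beta - r) * (beta ^+ 2 + c1 * beta + c0)).
    by rewrite pfac !derivE !hornerE /=; ring.
  (* P' has leading coefficient 4 l, degree 3 and value l s v at beta, so 4 d^3 <= |s v| for the
     critical distance d > D. *)
  have := lead_coef_exp_le_normc P^`() beta%:C _ cd0 cd_le.
  rewrite lP size_map_poly sp' lead_coef_map lp' horner_map !normc_real derE.
  rewrite [4 * l]mulrC !(normrM l) -mulrA ler_pM2l ?normr_gt0 // normr_nat.
  apply: lt_le_trans; rewrite ltr_pM2l ?ltr0n // ltrXn2r ?nnegrE //; lra.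
have := cd_le x%:C; rewrite pE deriv_map fmorph_root => /(_ dx).
rewrite -rmorphB normc_real -pE => cdx.
by have := lt_le_trans far (le_trans cdx xD); rewrite ltxx.
Qed.
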